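(* Consider the public budget model with linear valuations: one unit of a divisible good, $n\ge 1$ agents, where agent $i$ has a private value per unit $v_i\ge 0$ and a publicly known budget $B_i>0$. Let $\varphi=\frac{\sqrt5+1}{2}$. The Auction for Public Budgets (defined in the context) is truthful, is budget feasible, and has approximation ratio at most $\varphi$ for liquid welfare; that is, for every profile $(v_1,\dots,v_n)$, $(B_1,\dots,B_n)$, the allocation $\mathbf{x}$ it outputs on the true values satisfies $$\sum_{i=1}^n \min\{v_i x_i,B_i\}\ \ge\ \frac1\varphi\, OPT,$$ where $OPT=\max\{\sum_{i}\min\{v_i y_i,B_i\} : y_i\ge 0,\ \sum_i y_i\le 1\}$.
   Context: Model. A (direct, deterministic) auction receives reported values $(v_1,\dots,v_n)$ (the budgets are known to the auctioneer) and outputs an allocation $x_i\ge 0$ with $\sum_i x_i\le 1$ and payments $p_i\ge 0$. The utility of agent $i$ with true value $v_i$ is $v_i x_i-p_i$ if $p_i\le B_i$, and $-\infty$ if $p_i>B_i$. The auction is truthful if reporting the true value is a dominant strategy for every agent, i.e. for all reports of the others, it maximizes the agent's utility. It is budget feasible if $p_i\le B_i$ for every truth-telling agent $i$. The liquid welfare of an allocation $\mathbf{x}$ is $\overline W(\mathbf{x})=\sum_i\min\{v_i x_i,B_i\}$. Auction for Public Budgets. Here $\varphi=\frac{\sqrt5+1}{2}$ (so $\varphi^2=\varphi+1$). Relabel the agents so that $v_1\ge\dots\ge v_n$ (ties broken by a fixed order on the agents), and set $v_{n+1}=0$. Let $k$ be the maximum integer in $\{1,\dots,n\}$ with $\frac1\varphi\sum_{j=1}^k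 B_j\le v_k$, and $k=0$ if there is none (empty sums are $0$). Case I: $\frac1\varphi\sum_{j=1}^k B_j\ge v_{k+1}$. For $1\le i\le k$ put $\hat v_i=\frac{v_i}{\sum_{j=1}^k B_j}$ and $x_i=\frac{B_i}{\sum_{j=1}^k B_j}\min\{\hat v_i,1\}$; for $i>k$ put $x_i=0$. Case II: $\frac1\varphi\sum_{j=1}^k B_j< v_{k+1}$. For $1\le i\le k$ put $\hat v_i=\frac{v_i}{\varphi v_{k+1}}$ and $x_i=\frac{B_i}{\varphi v_{k+1}}\min\{\hat v_i,1\}$; put $x_{k+1}=\frac1\varphi-\sum_{i=1}^k\frac{B_i}{\varphi^2 v_{k+1}}$; for $i\ge k+2$ put $x_i=0$. Payments: $p_i=v_i\,x_i(v_i,v_{-i})-\int_0^{v_i}x_i(u,v_{-i})\,du$, where $x_i(u,v_{-i})$ is the amount that the allocation rule of the Auction for Public Budgets (sort the reported values, determine $k$, then allocate according to Case I or Case II) gives to agent $i$ when $i$ reports $u$ and the others report $v_{-i}$. *)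

(* Defs.v *)
From HB Require Import structures.
From mathcomp Require Import all_boot all_order all_fingroup all_algebra.
From mathcomp Require Import all_classical all_reals all_analysis.

Set Implicit Arguments.
Unset Strict Implicit.
Unset Printing Implicit Defensive.

Import Order.TTheory GRing.Theory Num.Theory.
Import numFieldNormedType.Exports.

Local Open Scope classical_set_scope.
Local Open Scope ring_scope.

Section Model.
Variables (R : realType) (n : nat).

Definition nonneg_profile (v : 'I_n -> R) : Prop := forall i, 0 <= v i.

(* The profile (u, v_{-i}). *)
Definition report (v : 'I_n -> R) (i : 'I_n) (u : R) : 'I_n -> R :=
  fun j => if j == i then u else v j.

Definition feasible_alloc : set ('I_n -> R) :=
  [set x | (forall i, 0 <= x i) /\ \sum_(i < n) x i <= 1].

(* The budgets are public, so an auction may depend on them: what is called an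
   auction here is the mechanism for one fixed budget vector. *)
Record auction := Auction {
  allocation : ('I_n -> R) -> 'I_n -> R;
  payment : ('I_n -> R) -> 'I_n -> R
}.

Definition valid_auction (A : auction) : Prop :=
  forall v, nonneg_profile v ->
    feasible_alloc (allocation A v) /\ (forall i, 0 <= payment A v i).

(* Utility of agent [i] with true value [t] and budget [b] at the reports [v]. *)
Definition utility (A : auction) (i : 'I_n) (t b : R) (v : 'I_n -> R) : \bar R :=
  if payment A v i <= b then (t * allocation A v i - payment A v i)%:E
  else -oo%E.

Definition truthful (B : 'I_n -> R) (A : auction) : Prop :=
  forall (i : 'I_n) (v : 'I_n -> R) (t u : R),
    nonneg_profile v -> 0 <= t -> 0 <= u ->
    (utility A i t (B i) (report v i u) <= utility A i t (B i) (report v i t))%E.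

(* In [payment A v i <= B i], [v i] is the true value of agent [i]; the other
   reports are arbitrary. *)
Definition budget_feasible (B : 'I_n -> R) (A : auction) : Prop :=
  forall v, nonneg_profile v -> forall i, payment A v i <= B i.

Definition liquid_welfare (v B x : 'I_n -> R) : R :=
  \sum_(i < n) Num.min (v i * x i) (B i).

Definition is_max (S : set R) (m : R) : Prop := S m /\ ubound S m.

(* [is_max] is a predicate, so existence of the maximum is part of the claim. *)
Definition approx_ratio_le (alpha : R) (B : 'I_n -> R) (A : auction) : Prop :=
  forall v, nonneg_profile v ->
    exists2 OPT : R,
      is_max [set liquid_welfare v B y | y in feasible_alloc] OPT &
      alpha^-1 * OPT <= liquid_welfare v B (allocation A v).

End Model.

Section PublicBudgets.
Variables (R : realType) (n : nat).

Definition phi : R := (Num.sqrt 5 + 1) / 2.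

(* The permutation [tie] gives the fixed order used to break ties. *)
Variables (tie : 'S_n) (B : 'I_n -> R).

Definition precedes (v : 'I_n -> R) : rel 'I_n :=
  fun i j => (v j < v i) || ((v i == v j) && (tie i <= tie j)%N).

Definition ranking (v : 'I_n -> R) : seq 'I_n := sort (precedes v) (enum 'I_n).

(* 0-based: [rank v i = r] means that [i] is agent r+1 after relabelling. *)
Definition rank (v : 'I_n -> R) (i : 'I_n) : nat := index i (ranking v).

(* 0-based: [sorted_value v r] is v_{r+1}; the default value of [nth] gives
   v_{n+1} = 0. *)
Definition sorted_value (v : 'I_n -> R) (r : nat) : R :=
  nth 0 (map v (ranking v)) r.

Definition top_budget (v : 'I_n -> R) (k : nat) : R :=
  \sum_(j <- take k (ranking v)) B j.

Definition cutoff (v : 'I_n -> R) : nat :=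
  \max_(1 <= k < n.+1 | phi^-1 * top_budget v k <= sorted_value v k.-1) k.

Definition apb_alloc (v : 'I_n -> R) (i : 'I_n) : R :=
  let k := cutoff v in
  let S := top_budget v k in
  let w := sorted_value v k in
  if w <= phi^-1 * S then
    if (rank v i < k)%N then B i / S * Num.min (v i / S) 1 else 0
  else
    if (rank v i < k)%N then B i / (phi * w) * Num.min (v i / (phi * w)) 1
    else if rank v i == k then
      phi^-1 - \sum_(j <- take k (ranking v)) B j / (phi ^+ 2 * w)
    else 0.

Definition apb_payment (v : 'I_n -> R) (i : 'I_n) : R :=
  v i * apb_alloc v i -
  \int[lebesgue_measure]_(u in `[0, v i]) apb_alloc (report v i u) i.

Definition public_budget_auction : auction R n :=
  Auction apb_alloc apb_payment.

End PublicBudgets.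

(* Main.v *)
(** Put [D := max S (phi * w)], where [S] is the total budget of the top [k]
agents (the winners) and [w] the value of agent k+1.  Both cases of the
auction give a winner [B_i / D * min (v_i / D) 1], and a loser [i] gets
[1/phi - T_i / (phi^2 * v_i)] if this is positive and [0] otherwise, [T_i] being
the budget of the agents before [i]; moreover [i] wins iff
[T_i + B_i <= phi * v_i].  The only global quantity, [D], is the largest [d]
such that the agents with [phi * v_j >= d] have total budget at least [d]; hence it
does not depend on the report of a winner, and it is at most [T_i + B_i] if [i]
wins only after raising its report.  So [x_i] is nondecreasing in the report of
[i], which gives truthfulness by Myerson's argument.  A winner with [v_i > D]
pays no more than at value [D], that is, at most [D * x_i = B_i].

For the ratio, weak duality with price [D / phi] gives
[OPT <= D / phi + \sum_(i winner) B_i * (1 - D / (phi * v_i))], while the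
auction achieves
[\sum_(i winner) B_i * min (v_i / D) 1 ^ 2 + (D - S) / phi^2], the last term
coming from agent k+1.  These are compared term by term using
[1 - 1 / (phi * z) <= phi * min z 1 ^ 2 - 1 / phi] for [z >= 1 / phi], which is
where the golden ratio enters: the cubic has the root [z = 1 / phi]. *)
Require Import Defs.
From mathcomp Require Import all_boot all_order all_fingroup all_algebra.
From mathcomp Require Import all_classical all_reals all_analysis.
From mathcomp Require Import lra ring zify.
Import Order.TTheory GRing.Theory Num.Theory.
Import numFieldNormedType.Exports.
Local Open Scope classical_set_scope.
Local Open Scope ring_scope.
Set Implicit Arguments.
Unset Strict Implicit.
Unset Printing Implicit Defensive.

(** * The golden ratio and the inequality behind the ratio bound *)

Section GoldenRatio.
Variable R : realType.
Local Notation phi := (phi R).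

Lemma phi_gt1 : 1 < phi.
Proof.
have s1 : 1 < Num.sqrt (5 : R) by rewrite -{1}[1]sqrtr1 ltr_sqrt ?ltr0n//; lra.
by rewrite /Defs.phi; lra.
Qed.

Lemma phi_gt0 : 0 < phi. Proof. exact: lt_trans ltr01 phi_gt1. Qed.

Lemma sqr_phi : phi ^+ 2 = phi + 1.
Proof.
have := @sqr_sqrtr R 5 (ler0n _ _); rewrite /Defs.phi; set s := Num.sqrt 5 => h.
by rewrite expr2 in h *; lra.
Qed.

Lemma phiV : phi^-1 = phi - 1.
Proof.
apply: (mulfI (lt0r_neq0 phi_gt0)); rewrite divff ?lt0r_neq0 ?phi_gt0//.
by have := sqr_phi; rewrite expr2; lra.
Qed.

Lemma phi_lt2 : phi < 2.
Proof.
have := sqr_phi; have := phi_gt1; rewrite expr2 => h1 h2; rewrite ltNge.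
apply/negP => h3; have : phi * 2 <= phi * phi by rewrite ler_pM2l// phi_gt0.
by lra.
Qed.

Lemma winner_ratio_ineq (z : R) : phi^-1 <= z ->
  1 - (phi * z)^-1 <= phi * Num.min z 1 ^+ 2 - phi^-1.
Proof.
move=> hz.
have p1 := phi_gt1; have p2 := phi_lt2; have ps := sqr_phi.
rewrite phiV in hz *; have z0 : 0 < z by lra.
rewrite invfM phiV; have zV0 : 0 < z^-1 by rewrite invr_gt0.
rewrite expr2 in ps.
have [z1|z1] := leP z 1; last first.
  have : 0 <= (phi - 1) * z^-1 by rewrite mulr_ge0// ltW//; lra.
  by rewrite expr1n mulr1; lra.
rewrite expr2 -subr_ge0.
(* The root [z = phi^-1 = phi - 1] is factored out; the remaining quadratic is at least [2 - phi]
   because [phi * z >= 1]. *)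
have -> : phi * (z * z) - (phi - 1) - (1 - (phi - 1) * z^-1)
   = (phi - 1) * z^-1 * ((z - (phi - 1)) * (phi ^+ 2 * z ^+ 2 + phi * z - phi)).
  have zz : z^-1 * z = 1 by rewrite mulVf// gt_eqF.
  transitivity (phi * (z * z) - phi + (phi - 1) * z^-1); first ring.
  rewrite !expr2.
  transitivity ((phi * phi - phi) * phi * (z^-1 * z) * (z * z)
    - phi * (phi * phi - phi) * (z^-1 * z) + (phi - 1) ^+ 2 * phi * z^-1
    + (z^-1 * z) * z * (phi - 1) * phi * (1 + phi - phi * phi) ); last ring.
  rewrite zz; have -> : phi * phi - phi = 1 by lra.
  have -> : (phi - 1) ^+ 2 * phi = phi - 1.
    have e : (phi - 1) * phi = 1 by lra.
    by rewrite expr2 -mulrA e mulr1.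
  by rewrite ps; ring.
apply: mulr_ge0; first by apply: mulr_ge0; [lra|exact: ltW].
apply: mulr_ge0; first lra.
have pz : 1 <= phi * z.
  have : phi * (phi - 1) <= phi * z by rewrite ler_pM2l// phi_gt0.
  by lra.
rewrite -exprMn.
have : 1 <= (phi * z) ^+ 2 by rewrite exprn_ege1.
lra.
Qed.

End GoldenRatio.

(** * Integrals of monotone functions *)

Section MonotoneIntegral.
Variable R : realType.
Local Notation mu := (@lebesgue_measure R).
Variable f : R -> R.
Hypothesis f_nd : forall x y : R, 0 <= x -> x <= y -> f x <= f y.

Lemma nondecreasing_integrable (t : R) : mu.-integrable `[0, t] (EFin \o f).
Proof.
apply: measurable_bounded_integrable => //.
- by rewrite /= lebesgue_measure_itv/=; case: ifP => _; rewrite ?ltry.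
(* Monotonicity is known only on nonnegative reals; [f (max 0 x)] is nondecreasing everywhere and
   agrees with [f] on the interval. *)
- apply: (eq_measurable_fun (fun x : R => f (Num.max 0 x))).
    by move=> x; rewrite inE/= in_itv/= => /andP[x0 _]; rewrite max_r.
  apply: measurable_realfun.nondecreasing_measurable => // x y xy.
  apply: f_nd; first by rewrite le_max lexx.
  by rewrite ge_max !le_max lexx xy orbT.
- exists (`|f 0| + `|f t|); split; first by rewrite num_real.
  move=> M hM x; rewrite /= in_itv/= => /andP[x0 xt].
  have := f_nd (lexx 0) x0; have := f_nd x0 xt.
  have := ler_norm (f t); have := ler_norm (- f 0); rewrite normrN.
  have := normr_ge0 (f t); have := normr_ge0 (f 0).
  by rewrite ler_norml; lra.
Qed.

Let F (t : R) := \int[mu]_(u in `[0, t]) f u.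

(** On []s, t]] the function lies between [f s] and [f t]. Truthfulness and both payment bounds rest
    on this estimate. *)
Lemma nondecreasing_integral_bounds (s t : R) : 0 <= s -> s <= t ->
  (t - s) * f s <= F t - F s <= (t - s) * f t.
Proof.
move=> s0 st; have it := @nondecreasing_integrable t.
rewrite /F Rintegral_itvB ?bnd_simp//.
have sub : `]s, t] `<=` `[0, t].
  by move=> x; rewrite /= !in_itv/= => /andP[sx ->]; rewrite andbT; lra.
have ist : mu.-integrable `]s, t] (EFin \o f) 
  by apply: integrableS it.
have ltmu : (mu `]s, t] < +oo)%E.
  by rewrite /= lebesgue_measure_itv/=; case: ifP => _; rewrite ?ltry.
have ic c : mu.-integrable `]s, t] (EFin \o cst c).
  by apply: measurable_bounded_integrable => //; exact: bounded_cst.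
have c_int c : \int[mu]_(x in `]s, t]) cst c x = (t - s) * c.
  rewrite Rintegral_cst//= lebesgue_measure_itv/= mulrC lte_fin.
  by case: ltgtP st => //= ->; rewrite subrr.
rewrite -!c_int; apply/andP; split; apply: le_Rintegral => // x;
  rewrite /= in_itv/= => /andP[sx xt]; apply: f_nd => //; lra.
Qed.

End MonotoneIntegral.

(** * Sorting the agents by value *)

Section Ranking.
Variables (R : realType) (n : nat) (tie : 'S_n) (v : 'I_n -> R).
Local Notation ranking := (ranking tie v).
Local Notation rank := (rank tie v).

Lemma precedes_total : total (precedes tie v).
Proof.
by move=> i j; rewrite /precedes; case: ltgtP => //= _; exact: leq_total.
Qed.

Lemma precedes_trans : transitive (precedes tie v).
Proof.
move=> j i l; rewrite /precedes.
move=> /orP[ij|/andP[/eqP -> ij]] /orP[jl|/andP[/eqP <- jl]].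
- by rewrite (lt_trans jl ij).
- by rewrite ij.
- by rewrite jl.
- by rewrite eqxx (leq_trans ij jl) orbT.
Qed.

Lemma precedes_anti : antisymmetric (precedes tie v).
Proof.
move=> i j; rewrite /precedes => /andP[].
case: ltgtP => //= _ ij ji; apply: (@perm_inj _ tie).
by apply/val_inj/eqP; rewrite eqn_leq ij ji.
Qed.

Lemma uniq_ranking : uniq ranking.
Proof. by rewrite sort_uniq enum_uniq. Qed.

Lemma mem_ranking i : i \in ranking.
Proof. by rewrite mem_sort mem_enum. Qed.

Lemma size_ranking : size ranking = n.
Proof. by rewrite size_sort size_enum_ord. Qed.

Lemma rank_lt i : (rank i < n)%N.
Proof. by rewrite -[X in (_ < X)%N]size_ranking index_mem mem_ranking. Qed.

Lemma nth_rank i0 i : nth i0 ranking (rank i) = i.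
Proof. exact/nth_index/mem_ranking. Qed.

Lemma rank_inj : injective rank.
Proof. by move=> i j ij; rewrite -(nth_rank i i) ij nth_rank. Qed.

Lemma rank_surj r : (r < n)%N -> exists i, rank i = r.
Proof.
move=> rn; exists (nth (Ordinal rn) ranking r).
by apply: index_uniq uniq_ranking; rewrite size_ranking.
Qed.

(** Sorting by a total order makes positions reflect that order. Ranks thus become pairwise
    comparisons, whose dependence on one report is explicit. *)
Lemma precedesE i j : precedes tie v i j = (rank i <= rank j)%N.
Proof.
have le_prec a b : (rank a <= rank b)%N -> precedes tie v a b.
  move=> ab; rewrite -(nth_rank i a) -(nth_rank i b).
  have refl : reflexive (precedes tie v).
    by move=> x; rewrite /precedes eqxx leqnn orbT.
  apply: (sorted_leq_nth precedes_trans refl _ (sort_sorted precedes_total _))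
    => //; by rewrite inE index_mem mem_ranking.
apply/idP/idP => [ij|]; last exact: le_prec.
rewrite leqNgt; apply/negP => ji.
have eij : i = j by apply: precedes_anti; rewrite ij le_prec// ltnW.
by rewrite eij ltnn in ji.
Qed.

Lemma rank_value i j : (rank i <= rank j)%N -> v j <= v i.
Proof. by rewrite -precedesE => /orP[/ltW//|/andP[/eqP -> _]]. Qed.

Lemma sorted_value_rank i : sorted_value tie v (rank i) = v i.
Proof.
rewrite /sorted_value (nth_map i) ?nth_rank//.
by rewrite index_mem mem_ranking.
Qed.

Lemma sorted_value_default r : (n <= r)%N -> sorted_value tie v r = 0.
Proof.
by move=> nr; rewrite /sorted_value nth_default// size_map size_ranking.
Qed.

Lemma sum_take_ranking (F : 'I_n -> R) k :
  \sum_(j <- take k ranking) F j = \sum_(j | (rank j < k)%N) F j.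
Proof.
rewrite big_uniq ?take_uniq ?uniq_ranking//; apply: eq_bigl => j.
by rewrite in_take ?mem_ranking.
Qed.

End Ranking.

(** * Winners, the common scale and a uniform formula for the shares *)

Section Allocation.
Variables (R : realType) (n : nat) (tie : 'S_n) (B : 'I_n -> R).
Hypothesis B_gt0 : forall i, 0 < B i.
Implicit Types (v : 'I_n -> R) (i j : 'I_n).
Local Notation phi := (phi R).
Local Notation rank := (rank tie).
Local Notation top_budget := (top_budget tie B).
Local Notation cutoff := (cutoff tie B).
Local Notation cutoff_value v := (sorted_value tie v (cutoff v)).
Local Notation alloc := (apb_alloc tie B).

Definition preceding_budget v i := top_budget v (rank v i).

(** Phrased without [cutoff], so that the effect of the agent's own report is visible. *)
Definition winner v i := preceding_budget v i + B i <= phi * v i.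

(* The common denominator of the winners' allocations: the first argument of the
   maximum prevails in Case I, the second in Case II. *)
Definition scale v :=
  Num.max (top_budget v (cutoff v)) (phi * cutoff_value v).

Lemma top_budgetE v k : top_budget v k = \sum_(j | (rank v j < k)%N) B j.
Proof. exact: sum_take_ranking. Qed.

Lemma preceding_budgetE v i :
  preceding_budget v i = \sum_(j | (j != i) && precedes tie v j i) B j.
Proof.
rewrite /preceding_budget top_budgetE; apply: eq_bigl => j.
by rewrite precedesE ltn_neqAle (inj_eq (@rank_inj _ _ _ _)).
Qed.

Lemma top_budgetS v i :
  top_budget v (rank v i).+1 = preceding_budget v i + B i.
Proof.
rewrite /preceding_budget !top_budgetE (bigD1 i)//= addrC; congr (_ + _).
apply: eq_bigl => j.
by rewrite ltnS ltn_neqAle (inj_eq (@rank_inj _ _ _ _)) andbC.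
Qed.

Lemma sum_budget_le (P Q : pred 'I_n) :
  subpred P Q -> \sum_(j | P j) B j <= \sum_(j | Q j) B j.
Proof.
move=> PQ; rewrite big_mkcond [leRHS]big_mkcond; apply: ler_sum => j _.
have := PQ j; case: (P j) => [->//|_].
by case: ifP => // _; exact: ltW.
Qed.

Lemma top_budget_le v k l : (k <= l)%N -> top_budget v k <= top_budget v l.
Proof.
by move=> kl; rewrite !top_budgetE; apply: sum_budget_le => j /leq_trans; exact.
Qed.

(** Along the ranking the cumulated budgets grow and the values fall, so [winner] holds on an
    initial segment, and [cutoff] is its length. *)
Lemma winnerE v i : winner v i = (rank v i < cutoff v)%N.
Proof.
have pV := phi_gt0 R.
rewrite /winner -top_budgetS; apply/idP/idP => [wi|].
  apply: (@leq_bigmax_seq _ (index_iota 1 n.+1) _ (fun k => k) (rank v i).+1).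
    by rewrite mem_index_iota/= ltnS rank_lt.
  by rewrite /= sorted_value_rank ler_pdivrMl.
apply: contraTT => Nwi; rewrite -leqNgt; apply/bigmax_leqP_seq => k.
rewrite mem_index_iota => /andP[k0 kn]; rewrite leqNgt => Ck.
apply/negP => ik; move/negP: Nwi; apply.
have [j jk] : exists j, rank v j = k.-1 by apply: rank_surj; lia.
move: Ck; rewrite -jk sorted_value_rank ler_pdivrMl// => Ck.
apply: (le_trans (top_budget_le v ik)); apply: (le_trans Ck).
by rewrite ler_pM2l// (@rank_value _ _ tie)//; lia.
Qed.

Lemma cutoff_le v : (cutoff v <= n)%N.
Proof.
by apply/bigmax_leqP_seq => k; rewrite mem_index_iota ltnS => /andP[].
Qed.

Lemma winners_budget v : top_budget v (cutoff v) = \sum_(j | winner v j) B j.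
Proof. by rewrite top_budgetE; apply: eq_bigl => j; rewrite winnerE. Qed.

Lemma cutoff_value_ge v i : ~~ winner v i -> v i <= cutoff_value v.
Proof.
rewrite winnerE -leqNgt => ki.
have [j jk] := rank_surj tie v (leq_ltn_trans ki (rank_lt tie v i)).
by rewrite -jk sorted_value_rank (@rank_value _ _ tie)// jk.
Qed.

Lemma cutoff_value_le v i : nonneg_profile v -> winner v i ->
  cutoff_value v <= v i.
Proof.
move=> v0; rewrite winnerE => ik.
have [kn|kn] := ltnP (cutoff v) n; last by rewrite sorted_value_default.
have [j jk] := rank_surj tie v kn.
by rewrite -jk sorted_value_rank (@rank_value _ _ tie)// jk ltnW.
Qed.

Lemma winners_budget_le v i : winner v i ->
  top_budget v (cutoff v) <= phi * v i.
Proof.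
rewrite winnerE => ik.
(* The last winner [j]: the budgets up to and including it are those of all winners, and no winner
   has a smaller value. *)
have [j jk] : exists j, rank v j = (cutoff v).-1.
  by apply: rank_surj; have := cutoff_le v; lia.
have : winner v j by rewrite winnerE jk; lia.
rewrite /winner -top_budgetS jk prednK; last lia.
move=> /le_trans; apply; rewrite ler_pM2l ?phi_gt0// (@rank_value _ _ tie)//.
lia.
Qed.

Lemma winner_scale_le v i : nonneg_profile v -> winner v i ->
  scale v <= phi * v i.
Proof.
move=> v0 wi; rewrite /scale ge_max winners_budget_le//=.
by rewrite ler_pM2l ?phi_gt0// cutoff_value_le.
Qed.

Lemma scale_ge0 v : nonneg_profile v -> 0 <= scale v.
Proof.
move=> v0; rewrite /scale le_max top_budgetE sumr_ge0// => j _; exact: ltW.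
Qed.

Lemma winner_scale_gt0 v i : winner v i -> 0 < scale v.
Proof.
move=> wi; rewrite /scale lt_max winners_budget (bigD1 i)//=.
by rewrite ltr_pwDl// sumr_ge0// => j _; exact: ltW.
Qed.

Lemma runner_up v : top_budget v (cutoff v) < phi * cutoff_value v ->
  exists r, [/\ rank v r = cutoff v, ~~ winner v r &
    v r = cutoff_value v].
Proof.
(* If [cutoff v] were [n], the next value would be the default 0 and the total budget negative. *)
move=> Sw; have kn : (cutoff v < n)%N.
  rewrite ltnNge; apply/negP => nk; move: Sw.
  rewrite sorted_value_default// mulr0 top_budgetE ltNge sumr_ge0// => j _.
  exact: ltW.
have [r rk] := rank_surj tie v kn; exists r; split => //.
  by rewrite winnerE rk ltnn.
by rewrite -rk sorted_value_rank.
Qed.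

(** With [sum_lt_scale], this makes [scale v] the largest [d] for which the agents with
    [phi * v j >= d] have total budget at least [d]. In Case II the runner-up is counted too: as it
    loses, the budgets up to and including it exceed [phi * v r]. *)
Lemma scale_le_sum v : nonneg_profile v ->
  scale v <= \sum_(j | scale v <= phi * v j) B j.
Proof.
move=> v0; rewrite {1}/scale ge_max; apply/andP; split.
  by rewrite winners_budget; apply: sum_budget_le => j; exact: winner_scale_le.
have [wS|Sw] := leP (phi * cutoff_value v) (top_budget v (cutoff v)).
  apply: (le_trans wS).
  by rewrite winners_budget; apply: sum_budget_le => j; exact: winner_scale_le.
have [r [rk Nwr vr]] := runner_up Sw.
rewrite -vr; move: (Nwr); rewrite /winner -ltNge -top_budgetS.
move=> /ltW/le_trans; apply.
rewrite top_budgetE; apply: sum_budget_le => j; rewrite ltnS => jr.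
rewrite /scale max_r ?(ltW Sw)// -vr ler_pM2l ?phi_gt0//.
exact: rank_value jr.
Qed.

(** A loser has [phi * v j] at most the scale, so only winners are counted, and their budget is at
    most the scale. *)
Lemma sum_lt_scale v d : nonneg_profile v -> scale v < d ->
  \sum_(j | d <= phi * v j) B j < d.
Proof.
rewrite /scale gt_max => v0 /andP[Sd wd]; apply: le_lt_trans Sd.
rewrite winners_budget; apply: sum_budget_le => j dj; apply: contraLR dj => Nwj.
rewrite -ltNge; apply: le_lt_trans wd.
by rewrite ler_pM2l ?phi_gt0// cutoff_value_ge.
Qed.

Lemma alloc_winner v i : winner v i ->
  alloc v i = B i / scale v * Num.min (v i / scale v) 1.
Proof.
rewrite winnerE /apb_alloc /scale => ->.
rewrite ler_pdivlMl ?phi_gt0//.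
by case: leP => [wS|Sw].
Qed.

(** Among losers only agent k+1 in Case II gets a share. In Case I, and for later agents in Case II,
    the test [preceding_budget v i < phi * v i] fails, so one formula free of [cutoff] covers all
    cases. *)
Lemma alloc_loser v i : ~~ winner v i ->
  alloc v i = if preceding_budget v i < phi * v i
              then phi^-1 - preceding_budget v i / (phi ^+ 2 * v i) else 0.
Proof.
move=> Nwi; have vk := cutoff_value_ge Nwi; have p0 := phi_gt0 R.
move: (Nwi); rewrite winnerE -leqNgt => ki; rewrite /apb_alloc ltnNge ki /=.
rewrite ler_pdivlMl//.
have Sk := top_budget_le v ki; rewrite -/(preceding_budget v i) in Sk.
case: (leP (phi * cutoff_value v)) => [wS|Sw].
  by rewrite ifF//; apply/negbTE; rewrite -leNgt; apply: le_trans Sk;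
     apply: le_trans wS; rewrite ler_pM2l.
case: eqVneq => [ik|ik].
  rewrite /preceding_budget ik; move: (Sw).
  rewrite -ik sorted_value_rank => ->.
  by rewrite mulr_suml.
rewrite ifF//; apply/negbTE; rewrite -leNgt.
have [r [rk Nwr vr]] := runner_up Sw.
apply: (@le_trans _ _ (phi * v r)); first by rewrite ler_pM2l// vr.
move: Nwr; rewrite /winner -ltNge -top_budgetS => /ltW/le_trans; apply.
by apply: top_budget_le; rewrite rk ltn_neqAle eq_sym ik.
Qed.

Lemma loser_runner_up v i : ~~ winner v i -> preceding_budget v i < phi * v i ->
  [/\ top_budget v (cutoff v) < phi * cutoff_value v,
      rank v i = cutoff v & v i = cutoff_value v].
Proof.
move=> Nwi Tv; have vk := cutoff_value_ge Nwi; have p0 := phi_gt0 R.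
move: (Nwi); rewrite winnerE -leqNgt => ki.
have Sw : top_budget v (cutoff v) < phi * cutoff_value v.
  apply: (le_lt_trans (top_budget_le v ki)); apply: (lt_le_trans Tv).
  by rewrite ler_pM2l.
have [r [rk Nwr vr]] := runner_up Sw.
have ik : rank v i = cutoff v.
  apply/eqP; rewrite eqn_leq ki andbT leqNgt; apply/negP => ki'.
  move: Tv; rewrite ltNge => /negP; apply.
  apply: (@le_trans _ _ (phi * v r)); first by rewrite ler_pM2l// vr.
  move: Nwr; rewrite /winner -ltNge -top_budgetS => /ltW/le_trans; apply.
  by apply: top_budget_le; rewrite rk.
by split => //; rewrite -ik sorted_value_rank.
Qed.

(** * Effect of changing a single report *)

Lemma report_nonneg v i u : nonneg_profile v -> 0 <= u ->
  nonneg_profile (report v i u).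
Proof. by move=> v0 u0 j; rewrite /report; case: eqP. Qed.

Lemma report_self v i u : report v i u i = u.
Proof. by rewrite /report eqxx. Qed.

Lemma report_other v i u j : j != i -> report v i u j = v j.
Proof. by rewrite /report => /negbTE ->. Qed.

Lemma report_id v i : report v i (v i) = v.
Proof. by apply/funext => j; rewrite /report; case: eqP => [->|]. Qed.

Lemma report_report v i u u' : report (report v i u) i u' = report v i u'.
Proof. by apply/funext => j; rewrite /report; case: eqP. Qed.

Lemma report_le v i u u' j : u <= u' -> report v i u j <= report v i u' j.
Proof. by rewrite /report; case: eqP. Qed.

Lemma preceding_budget_report v i u u' : u <= u' ->
  preceding_budget (report v i u') i <= preceding_budget (report v i u) i.
Proof.
move=> uu'; rewrite !preceding_budgetE; apply: sum_budget_le => j.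
case: (eqVneq j i) => //= ji.
rewrite /precedes !report_self !report_other//.
move=> /orP[u'v|/andP[/eqP vu' ji_tie]].
  by rewrite (le_lt_trans uu').
by rewrite ji_tie andbT; move: uu'; rewrite -vu'; case: ltgtP.
Qed.

Lemma winner_report v i u u' : u <= u' ->
  winner (report v i u) i -> winner (report v i u') i.
Proof.
move=> uu'; rewrite /winner !report_self => wu.
apply: (@le_trans _ _ (phi * u)); last by rewrite ler_pM2l ?phi_gt0.
by apply: le_trans wu; rewrite lerD2r preceding_budget_report.
Qed.

Lemma sum_above_le v i d : phi * v i < d ->
  \sum_(j | (j != i) && (d <= phi * v j)) B j <= preceding_budget v i.
Proof.
move=> vd; rewrite preceding_budgetE; apply: sum_budget_le => j /andP[-> dj] /=.
apply/orP; left; rewrite -(ltr_pM2l (phi_gt0 R)); exact: lt_le_trans dj.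
Qed.

(** Any other agent counted at level [d] has value above [u], hence precedes [i] at report [u];
    agent [i] itself adds at most [B i]. *)
Lemma sum_report_le v i u u' d : phi * u < d ->
  \sum_(j | d <= phi * report v i u' j) B j <=
  preceding_budget (report v i u) i + B i.
Proof.
move=> ud; have ud' : phi * report v i u i < d by rewrite report_self.
have := sum_above_le ud'; rewrite -(lerD2r (B i)); apply: le_trans.
rewrite (bigID (pred1 i)) /= addrC lerD//; last first.
  have -> : B i = \sum_(j | j == i) B j by rewrite big_pred1_eq.
  by apply: sum_budget_le => j /andP[].
apply: sum_budget_le => j /andP[dj ji].
by rewrite ji/= report_other// -(report_other v u' ji).
Qed.

(** The largest admissible [d] is compared at both reports: a higher report can only enlarge the
    sums, and no new level becomes admissible. *)
Lemma scale_report v i u u' : nonneg_profile v -> 0 <= u -> u <= u' ->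
  winner (report v i u) i -> scale (report v i u') = scale (report v i u).
Proof.
move=> v0 u0 uu' wi.
have vu0 := report_nonneg i v0 u0.
have vu'0 := report_nonneg i v0 (le_trans u0 uu').
have p0 := phi_gt0 R.
apply/eqP; rewrite eq_le.
apply/andP; split; rewrite leNgt; apply/negP => lt_scale.
- have := scale_le_sum vu'0; set d := scale (report v i u') in lt_scale *.
  (* If [phi * u < d], the budget counted at [d] is at most that up to and including [i], hence at
     most [phi * u] since [i] wins. Otherwise [i] is counted at both reports and the sums agree. *)
  have [ud|du] := ltP (phi * u) d.
    move=> /le_trans/(_ (sum_report_le v i u' ud)).
    rewrite leNgt => /negP; apply.
    by apply: le_lt_trans ud; move: wi; rewrite /winner report_self.
  have := sum_lt_scale vu0 lt_scale; rewrite ltNge => /negP h1 h2; apply: h1.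
  apply: (le_trans h2); apply: sum_budget_le => j.
  by rewrite /report; case: eqP => // _ _.
- have := sum_lt_scale vu'0 lt_scale; rewrite ltNge => /negP; apply.
  apply: (le_trans (scale_le_sum vu0)).
  apply: sum_budget_le => j /le_trans; apply.
  by rewrite ler_pM2l// report_le.
Qed.

(** As [i] loses at [u], a level [d] above the right-hand side is also above [phi * u], and
    [sum_report_le] keeps the budget counted there below [d]. *)
Lemma scale_report_le v i u u' : nonneg_profile v -> 0 <= u -> u <= u' ->
  ~~ winner (report v i u) i ->
  scale (report v i u') <= preceding_budget (report v i u) i + B i.
Proof.
move=> v0 u0 uu'; rewrite /winner report_self -ltNge => Nw.
rewrite leNgt; apply/negP => Td.
have /le_lt_trans := sum_report_le v i u' (lt_trans Nw Td); move=> /(_ _ Td).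
rewrite ltNge scale_le_sum//; apply: report_nonneg => //.
exact: le_trans uu'.
Qed.

Lemma preceding_budget_ge0 v i : 0 <= preceding_budget v i.
Proof. by rewrite preceding_budgetE sumr_ge0// => j _; exact: ltW. Qed.

Lemma runner_up_alloc_ge0 (t u : R) : 0 <= t -> t < phi * u ->
  0 <= phi^-1 - t / (phi ^+ 2 * u).
Proof.
move=> t0 tu; have p0 := phi_gt0 R.
have u0 : 0 < u by rewrite -(pmulr_rgt0 _ p0) (le_lt_trans t0).
rewrite subr_ge0 expr2 -mulrA invfM mulrCA -[leRHS]mulr1 ler_pM2l ?invr_gt0//.
by rewrite ler_pdivrMr ?mulr_gt0// mul1r ltW.
Qed.

Lemma alloc_ge0 v i : nonneg_profile v -> 0 <= alloc v i.
Proof.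
move=> v0; have [wi|Nwi] := boolP (winner v i).
  have D0 := scale_ge0 v0.
  by rewrite alloc_winner// mulr_ge0 ?le_min ?ler01 ?divr_ge0 ?(ltW (B_gt0 i)).
rewrite alloc_loser//; case: ifP => // Tv.
exact: runner_up_alloc_ge0 (preceding_budget_ge0 _ _) Tv.
Qed.

Lemma alloc_report_nondecreasing v i u u' : nonneg_profile v -> 0 <= u ->
  u <= u' -> alloc (report v i u) i <= alloc (report v i u') i.
Proof.
move=> v0 u0 uu'; have p0 := phi_gt0 R.
have u'0 := le_trans u0 uu'.
have vu0 := report_nonneg i v0 u0; have vu'0 := report_nonneg i v0 u'0.
have [wi|Nwi] := boolP (winner (report v i u) i).
  have wi' := winner_report uu' wi.
  rewrite !alloc_winner// !report_self (scale_report v0 u0 uu' wi).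
  have D0 := winner_scale_gt0 wi.
  rewrite ler_pM2l ?divr_gt0// le_min ge_min ge_min lexx orbT andbT.
  by rewrite ler_pM2r ?invr_gt0// uu'.
rewrite [leLHS]alloc_loser// report_self.
case: ifPn => [Tu|_]; last exact: alloc_ge0.
have T0 := preceding_budget_ge0 (report v i u) i.
have u_gt0 : 0 < u by rewrite -(pmulr_rgt0 _ p0) (le_lt_trans T0).
have := Nwi; rewrite /winner report_self -ltNge => uTB.
have [wi'|Nwi'] := boolP (winner (report v i u') i).
  have D0 := winner_scale_gt0 wi'.
  have DTB := scale_report_le v0 u0 uu' Nwi.
  have := winner_scale_le vu'0 wi'; rewrite report_self => Du'.
  rewrite alloc_winner// report_self.
  set D := scale _ in D0 DTB Du' *.
  set T := preceding_budget _ _ in T0 Tu uTB DTB *.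
  (* This value separates the shares: the new one is above it since [u' / D >= phi^-1], the old one
     below it since [phi * u < T + B i] and [D <= T + B i]. *)
  apply: (@le_trans _ _ (B i / D * phi^-1)); last first.
    rewrite ler_pM2l ?divr_gt0// le_min ler_pdivlMr// ler_pdivrMl// Du'/=.
    by rewrite invf_le1// ltW// phi_gt1.
  have -> : phi^-1 - T / (phi ^+ 2 * u) = (1 - T / (phi * u)) * phi^-1.
    by rewrite expr2 -mulrA !invfM; ring.
  rewrite ler_pM2r ?invr_gt0//.
  have TB0 : 0 < T + B i by rewrite ltr_wpDl.
  apply: (@le_trans _ _ (B i / (T + B i))); last first.
    by rewrite ler_pM2l// lef_pV2.
  have -> : B i / (T + B i) = 1 - T / (T + B i) by field; rewrite gt_eqF.
  rewrite lerD2l lerN2 ler_wpM2l// lef_pV2 ?posrE ?mulr_gt0//; exact: ltW.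
rewrite alloc_loser// report_self.
have TT := preceding_budget_report v i uu'.
rewrite ifT; last first.
  by apply: (le_lt_trans TT); apply: (lt_le_trans Tu); rewrite ler_pM2l.
rewrite lerD2l lerN2 ler_pM ?preceding_budget_ge0// ?invr_ge0.
  by rewrite mulr_ge0// exprn_ge0// ltW.
rewrite lef_pV2 ?posrE ?mulr_gt0 ?exprn_gt0//; last exact: lt_le_trans uu'.
by rewrite ler_pM2l ?exprn_gt0.
Qed.

(** By [sum_lt_scale] at level [phi * scale v], the agents of value at least [scale v] have total
    budget below that level; they include [i] and all agents ahead of it after the lowered
    report. *)
Lemma winner_report_scale v i : nonneg_profile v -> winner v i ->
  scale v < v i -> winner (report v i (scale v)) i.
Proof.
move=> v0 wi Dv; have p1 := phi_gt1 R; have D0 := winner_scale_gt0 wi.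
set D := scale v in Dv D0 *.
rewrite /winner report_self.
have DD : D < phi * D by rewrite ltr_pMl.
apply: le_trans (ltW (sum_lt_scale v0 DD)).
rewrite (bigD1 i)/=; last by rewrite ler_pM2l ?phi_gt0// ltW.
rewrite [leRHS]addrC lerD2r preceding_budgetE.
apply: sum_budget_le => j /andP[ji].
rewrite /precedes report_self report_other// ji andbT ler_pM2l ?phi_gt0//.
by case/orP => [/ltW//|/andP[/eqP <-]].
Qed.

(** * Payments and their bounds *)

Local Notation payment := (apb_payment tie B).

Lemma payment_report v i u : payment (report v i u) i =
  u * alloc (report v i u) i -
  \int[lebesgue_measure]_(s in `[0, u]) alloc (report v i s) i.
Proof.
rewrite /apb_payment report_self; congr (_ - _).
by apply: eq_Rintegral => s _; rewrite report_report.
Qed.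

Lemma integral_alloc_bounds v i s t : nonneg_profile v -> 0 <= s -> s <= t ->
  (t - s) * alloc (report v i s) i <=
    \int[lebesgue_measure]_(u in `[0, t]) alloc (report v i u) i -
    \int[lebesgue_measure]_(u in `[0, s]) alloc (report v i u) i
  <= (t - s) * alloc (report v i t) i.
Proof.
move=> v0; apply: (nondecreasing_integral_bounds
  (f := fun u => alloc (report v i u) i)) => x y.
exact: alloc_report_nondecreasing.
Qed.

Lemma integral_alloc_ge0 v i t : nonneg_profile v ->
  0 <= \int[lebesgue_measure]_(u in `[0, t]) alloc (report v i u) i.
Proof.
move=> v0; apply: Rintegral_ge0 => u; rewrite /= in_itv/= => /andP[u0 _].
exact/alloc_ge0/report_nonneg.
Qed.

Lemma payment_ge0 v i : nonneg_profile v -> 0 <= payment v i.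
Proof.
move=> v0; rewrite -(report_id v i) payment_report.
have /andP[_] := integral_alloc_bounds i v0 (lexx 0) (v0 i).
by rewrite set_itv1 Rintegral_set1; lra.
Qed.

Lemma payment_le_budget v i : nonneg_profile v -> payment v i <= B i.
Proof.
move=> v0; have p0 := phi_gt0 R; have p1 := phi_gt1 R.
have int0 := integral_alloc_ge0 i (v i) v0.
(* For a loser, and for a winner of value at most the scale, already [v i * alloc v i] is at most
   [B i]. *)
have [wi|Nwi] := boolP (winner v i); last first.
  apply: (@le_trans _ _ (v i * alloc v i)).
    by rewrite /apb_payment gerBl.
  rewrite alloc_loser//; case: ifP => [Tv|_]; last by rewrite mulr0 ltW.
  have T0 := preceding_budget_ge0 v i.
  have vi0 : 0 < v i by rewrite -(pmulr_rgt0 _ p0) (le_lt_trans T0).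
  have -> : v i * (phi^-1 - preceding_budget v i / (phi ^+ 2 * v i)) =
     (phi * v i - preceding_budget v i) / phi ^+ 2.
    by field; rewrite !gt_eqF.
  rewrite ler_pdivrMr ?exprn_gt0//.
  apply: (@le_trans _ _ (B i)).
    by move: Nwi; rewrite /winner -ltNge; lra.
  by rewrite ler_pMr// exprn_ege1// ltW.
have D0 := winner_scale_gt0 wi.
have [vD|Dv] := leP (v i) (scale v).
  apply: (@le_trans _ _ (v i * alloc v i)).
    by rewrite /apb_payment gerBl.
  rewrite alloc_winner// min_l ?ler_pdivrMr ?mul1r//.
  have -> : v i * (B i / scale v * (v i / scale v)) =
     B i * (v i / scale v) ^+ 2.
    by rewrite expr2; ring.
  rewrite ger_pMr// exprn_ile1 ?divr_ge0// ?(ltW D0)//.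
  by rewrite ler_pdivrMr// mul1r.
have wD := winner_report_scale v0 wi Dv.
have sD : scale (report v i (scale v)) = scale v.
  by rewrite -(scale_report v0 (ltW D0) (ltW Dv) wD) report_id.
have aD : alloc (report v i (scale v)) i = B i / scale v.
  by rewrite alloc_winner// sD report_self divff ?gt_eqF// minxx mulr1.
have av : alloc v i = B i / scale v.
  by rewrite alloc_winner// min_r ?mulr1// ler_pdivlMr// mul1r ltW.
(* From [scale v] to [v i] the integral grows by at least [(v i - scale v) * (B i / scale v)],
   leaving a payment of at most [B i]. *)
have /andP[+ _] := integral_alloc_bounds i v0 (ltW D0) (ltW Dv).
have := integral_alloc_ge0 i (scale v) v0.
rewrite aD mulrBl [scale v * _]mulrC divfK ?gt_eqF//.
by rewrite /apb_payment av; lra.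
Qed.

(** * Feasibility of the allocation and its liquid welfare *)

Lemma losers_alloc v :
  (scale v = top_budget v (cutoff v) /\
     forall i, ~~ winner v i -> alloc v i = 0) \/
  exists r, [/\ ~~ winner v r, scale v = phi * v r,
    preceding_budget v r = top_budget v (cutoff v),
    top_budget v (cutoff v) < phi * v r &
    forall i, ~~ winner v i -> i != r -> alloc v i = 0].
Proof.
have [wS|Sw] := leP (phi * cutoff_value v) (top_budget v (cutoff v)).
  left; split; first by rewrite /scale max_l.
  move=> i Nwi; rewrite alloc_loser//; case: ifP => // Tv.
  by have [] := loser_runner_up Nwi Tv; rewrite ltNge wS.
right; have [r [rk Nwr vr]] := runner_up Sw; exists r; rewrite vr; split => //.
- by rewrite /scale max_r// ltW.
- by rewrite /preceding_budget rk.
- move=> i Nwi ir; rewrite alloc_loser//; case: ifP => // Tv.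
  have [_ ik _] := loser_runner_up Nwi Tv.
  by case/eqP: ir; apply: (@rank_inj _ _ tie v); rewrite ik rk.
Qed.

Lemma sum_alloc_le1 v : nonneg_profile v -> \sum_i alloc v i <= 1.
Proof.
move=> v0; have p0 := phi_gt0 R; have p1 := phi_gt1 R.
have win : \sum_(i | winner v i) alloc v i <= top_budget v (cutoff v) / scale v.
  rewrite winners_budget mulr_suml; apply: ler_sum => i wi.
  have D0 := winner_scale_gt0 wi.
  by rewrite alloc_winner// ger_pMr ?divr_gt0// ge_min lexx orbT.
rewrite (bigID (winner v))/=.
have [[SD l0]|[r [Nwr Dr TS Sr l0]]] := losers_alloc v.
  rewrite [X in _ + X]big1// addr0; apply: (le_trans win); rewrite -SD.
  have [->|D0] := eqVneq (scale v) 0; first by rewrite mul0r.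
  by rewrite divff.
rewrite [X in _ + X](bigD1 r)//=.
rewrite [X in _ + (_ + X)]big1 => [|i /andP[]]; last exact: l0.
rewrite addr0 alloc_loser// TS Sr.
have S0 : 0 <= top_budget v (cutoff v).
  by rewrite winners_budget sumr_ge0// => j _; exact: ltW.
set S := top_budget _ _ in win S0 Sr *.
have vr0 : 0 < v r by rewrite -(pmulr_rgt0 _ p0) (le_lt_trans S0).
rewrite Dr in win.
have -> : S / (phi ^+ 2 * v r) = phi^-1 * (S / (phi * v r)).
  by field; rewrite !gt_eqF.
have q1 : S / (phi * v r) <= 1 by rewrite ler_pdivrMr ?mulr_gt0// mul1r ltW.
set q := S / (phi * v r) in win q1 *.
have pV1 : phi^-1 <= 1 by rewrite invf_le1// ltW.
(* Winners use at most [q] and the runner-up [(1 - q) / phi]; this product is the slack. *)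
have : 0 <= (1 - phi^-1) * (1 - q) by rewrite mulr_ge0// subr_ge0.
by lra.
Qed.

Lemma liquid_welfare_alloc_ge v : nonneg_profile v ->
  \sum_(i | winner v i) B i * Num.min (v i / scale v) 1 ^+ 2 +
    phi^-1 * (phi^-1 * (scale v - top_budget v (cutoff v)))
  <= liquid_welfare v B (alloc v).
Proof.
move=> v0; have p0 := phi_gt0 R; have p1 := phi_gt1 R.
have term_ge0 i : 0 <= Num.min (v i * alloc v i) (B i).
  by rewrite le_min (ltW (B_gt0 i)) mulr_ge0 ?alloc_ge0.
rewrite /liquid_welfare [leRHS](bigID (winner v))/= lerD//.
  apply: ler_sum => i wi; have D0 := winner_scale_gt0 wi.
  rewrite alloc_winner//; set z := v i / scale v.
  have z0 : 0 <= z by rewrite divr_ge0// ltW.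
  have -> : v i * (B i / scale v * Num.min z 1) = B i * (z * Num.min z 1).
    by rewrite /z; ring.
  rewrite le_min !expr2 ler_pM2l//; apply/andP; split.
    by rewrite ler_wpM2r ?ge_min ?lexx// le_min z0 ler01.
  by rewrite ger_pMr// mulr_ile1 ?ge_min ?lexx ?orbT// le_min z0 ler01.
have [[-> _]|[r [Nwr Dr TS Sr l0]]] := losers_alloc v.
  by rewrite subrr !mulr0 sumr_ge0.
rewrite (bigD1 r)//= ler_wpDr ?sumr_ge0// alloc_loser// TS Sr Dr.
have S0 : 0 <= top_budget v (cutoff v).
  by rewrite winners_budget sumr_ge0// => j _; exact: ltW.
have SB : phi * v r < top_budget v (cutoff v) + B r.
  by move: Nwr; rewrite /winner TS -ltNge.
set S := top_budget _ _ in S0 Sr SB *.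
have vr0 : 0 < v r by rewrite -(pmulr_rgt0 _ p0) (le_lt_trans S0).
have -> : v r * (phi^-1 - S / (phi ^+ 2 * v r)) =
    phi^-1 * (phi^-1 * (phi * v r - S)).
  by field; rewrite !gt_eqF.
(* The budget does not cap the runner-up's value: as it loses, [phi * v r - S < B r]. *)
rewrite le_min lexx/= !ler_pdivrMl//.
apply: (@le_trans _ _ (B r)); first lra.
by rewrite mulrA ler_pMl// -expr2 exprn_ege1// ltW.
Qed.

(* Weak duality, with [lam] the price of the unit-supply constraint. *)
Lemma liquid_welfare_le v y lam : nonneg_profile v -> feasible_alloc y ->
  0 <= lam -> (forall i, winner v i -> 0 < v i) ->
  (forall i, winner v i -> lam <= v i) ->
  (forall i, ~~ winner v i -> v i <= lam) ->
  liquid_welfare v B y <= lam + \sum_(i | winner v i) B i * (1 - lam / v i).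
Proof.
move=> v0 [y0 y1] lam0 wpos wlam llam.
have le1 : \sum_i lam * y i <= lam.
  by rewrite -mulr_sumr ler_piMr.
rewrite -[leRHS]addrC -lerBlDr.
apply: (@le_trans _ _ (liquid_welfare v B y - \sum_i lam * y i)).
  by rewrite lerD2l lerN2.
rewrite /liquid_welfare -sumrB [leRHS]big_mkcond/=; apply: ler_sum => i _.
have y0i := y0 i.
case: ifPn => [wi|Nwi]; last first.
  by rewrite subr_le0 ge_min ler_wpM2r// llam.
have vi := wpos i wi; set m := Num.min _ _.
have mv : m <= v i * y i by rewrite /m ge_min lexx.
have mB : m <= B i by rewrite /m ge_min lexx orbT.
have lv : 0 <= 1 - lam / v i by rewrite subr_ge0 ler_pdivrMr// mul1r wlam.
apply: (@le_trans _ _ (m * (1 - lam / v i))); last by rewrite ler_wpM2r.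
rewrite mulrBr mulr1 lerD2l lerN2 mulrCA ler_wpM2l//.
by rewrite ler_pdivrMr// mulrC.
Qed.

Lemma liquid_welfare_ratio v y : nonneg_profile v -> feasible_alloc y ->
  liquid_welfare v B y <= phi * liquid_welfare v B (alloc v).
Proof.
move=> v0 fy; have p0 := phi_gt0 R; have p1 := phi_gt1 R.
have D0 := scale_ge0 v0; set D := scale v in D0 *.
have wpos i : winner v i -> 0 < v i.
  move=> wi; rewrite -(pmulr_rgt0 _ p0).
  exact: lt_le_trans (winner_scale_gt0 wi) (winner_scale_le v0 wi).
apply: (le_trans (liquid_welfare_le (lam := phi^-1 * D) v0 fy _ wpos _ _)).
- by rewrite mulr_ge0// invr_ge0 ltW.
- by move=> i wi; rewrite ler_pdivrMl// winner_scale_le.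
- move=> i Nwi; rewrite ler_pdivlMl// /D /scale le_max; apply/orP; right.
  by rewrite ler_pM2l// cutoff_value_ge.
have := liquid_welfare_alloc_ge v0; rewrite -(ler_pM2l p0); apply: le_trans.
(* Scaled by [phi], the runner-up term is [phi^-1 * (D - S)]. Its first part cancels the price in
   the dual bound; the second is split into [phi^-1 * B i] over the winners, leaving
   [winner_ratio_ineq] at [z = v i / D]. *)
rewrite mulrDr mulVKf ?gt_eqF// winners_budget mulrBr.
rewrite [leRHS]addrCA lerD2l !mulr_sumr -sumrB; apply: ler_sum => i wi.
have DD := winner_scale_gt0 wi; have vi := wpos i wi.
have hz : phi^-1 <= v i / D.
  by rewrite ler_pdivlMr// ler_pdivrMl// winner_scale_le.
have := ler_wpM2l (ltW (B_gt0 i)) (winner_ratio_ineq hz).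
have -> : (phi * (v i / D))^-1 = phi^-1 * D / v i.
  by rewrite (invfM phi) (invf_div (v i)) mulrA.
by move=> /le_trans; apply; rewrite mulrBr mulrCA [_ * phi^-1]mulrC.
Qed.

(** * Validity and truthfulness *)

Lemma apb_valid : valid_auction (public_budget_auction tie B).
Proof.
by move=> v v0; split=> [|i]; [split=> [i|] /=|];
  [exact: alloc_ge0|exact: sum_alloc_le1|exact: payment_ge0].
Qed.

(** Payments respect the budgets, so utilities are finite. Reporting [u] yields [(t - u)] times the
    share at [u] plus the integral of the shares up to [u]; the truth yields the integral up to
    [t]. *)
Lemma apb_truthful : truthful B (public_budget_auction tie B).
Proof.
move=> i v t u v0 t0 u0; rewrite /utility /=.
rewrite !payment_le_budget ?lee_fin; try exact: report_nonneg.
rewrite !payment_report; have [tu|ut] := leP t u.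
  by have /andP[_] := integral_alloc_bounds i v0 t0 tu; lra.
by have /andP[+ _] := integral_alloc_bounds i v0 u0 (ltW ut); lra.
Qed.

End Allocation.

(** * Existence of an optimal allocation *)

Section Optimum.
Variables (R : realType) (n : nat).
Implicit Types v B y : 'I_n -> R.

Lemma continuous_sumr (T : topologicalType) (f : 'I_n -> T -> R) :
  (forall i, continuous (f i)) -> continuous (fun x => \sum_i f i x).
Proof.
by move=> cf; apply: continuous_big => //; exact: add_continuous.
Qed.

(** Each share is at most the sum, so the set is a closed part of the unit cube; row vectors carry
    the topology. *)
Lemma compact_feasible_alloc :
  compact [set y : 'rV[R]_n | @feasible_alloc R n (y ord0)].
Proof.
have -> : [set y : 'rV[R]_n | @feasible_alloc R n (y ord0)] =
    [set y | forall i, `[0, 1]%classic (y ord0 i)] `&`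
    [set y | \sum_i y ord0 i <= 1].
  apply/seteqP; split => y /= [y0 y1]; split => // i; last first.
    by have := y0 i; rewrite /= in_itv/= => /andP[].
  rewrite in_itv/= y0 (le_trans _ y1)// (bigD1 i)//= lerDl.
  by apply: sumr_ge0.
apply: compact_closedI.
  apply: (@rV_compact R n (fun=> `[0, 1]%classic)) => _; exact: segment_compact.
apply: (@closed_comp _ _ (fun y : 'rV[R]_n => \sum_i y ord0 i)
   [set x | x <= 1]); last exact: closed_le.
by move=> y _; apply: continuous_sumr => i; exact: coord_continuous.
Qed.

(** [is_max] asks for an attained optimum, which the extreme value theorem supplies. *)
Lemma max_liquid_welfare v B :
  exists2 y, feasible_alloc y &
    forall y', feasible_alloc y' ->
      liquid_welfare v B y' <= liquid_welfare v B y.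
Proof.
pose W (y : 'rV[R]_n) := liquid_welfare v B (y ord0).
have [||y /set_mem fy maxy] := @EVT_max_rV _ _ W _ _ compact_feasible_alloc.
- exists (\row_i 0); split => [i|]; first by rewrite mxE.
  by rewrite big1 => [|i _]; rewrite ?mxE.
- apply: continuous_subspaceT; apply: continuous_sumr => i y.
  apply: (@continuous_min _ _ (fun y : 'rV[R]_n => v i * y ord0 i) (fun=> B i)).
    apply: continuousM; first exact: cst_continuous.
    exact: (@coord_continuous R 1 n ord0 i).
  exact: cst_continuous.
exists (y ord0) => // y' fy'.
have row_y' : (\row_i y' i : 'rV[R]_n) ord0 = y'.
  by apply/funext => i; rewrite mxE.
by have := maxy (\row_i y' i); rewrite /W row_y'; apply; rewrite inE/= row_y'.
Qed.

End Optimum.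

Theorem theorem2p2 (R : realType) (n : nat) (n_ge1 : (1 <= n)%N)
    (tie : 'S_n) (B : 'I_n -> R) (B_gt0 : forall i : 'I_n, 0 < B i) :
  [/\ valid_auction (public_budget_auction tie B),
      truthful B (public_budget_auction tie B),
      budget_feasible B (public_budget_auction tie B) &
      approx_ratio_le (phi R) B (public_budget_auction tie B)].
Proof.
split; [exact: apb_valid|exact: apb_truthful| |].
  by move=> v v0 i; exact: payment_le_budget.
move=> v v0; have [y fy maxy] := max_liquid_welfare v B.
exists (liquid_welfare v B y).
  by split; [exists y|move=> _ [y' fy' <-]; exact: maxy].
by rewrite ler_pdivrMl ?phi_gt0// liquid_welfare_ratio.
Qed.
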